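(* Let $\hat H=\sum_{\bm R\in\Lambda}\hat H_{\bm R}$ be a $\mathrm{U}(1)$-symmetric free-fermion Hamiltonian with local terms $\hat H_{\bm R}=\hat{\bm c}^\dagger h_{\bm R}\hat{\bm c}+C_{\bm R}$, where each $h_{\bm R}$ is a Hermitian matrix and $C_{\bm R}\in\mathbb R$. For each $\bm R$ let $\bm\psi_{\bm R\alpha}$ ($\alpha=1,\dots,A_{\bm R}$) be an orthonormal family of eigenvectors of $h_{\bm R}$ belonging to (all of) its positive eigenvalues, counted with multiplicity, and let $\bm\phi_{\bm R\beta}$ ($\beta=1,\dots,B_{\bm R}$) be an orthonormal family of eigenvectors belonging to (all of) its negative eigenvalues, counted with multiplicity. Put $\hat\psi_{\bm R\alpha}=\bm\psi_{\bm R\alpha}^\dagger\hat{\bm c}$ and $\hat\phi_{\bm R\beta}=\bm\phi_{\bm R\beta}^\dagger\hat{\bm c}$. Then $\hat H=\sum_{\bm R}\hat H_{\bm R}$ is frustration-free if and only if $$\{\hat\psi_{\bm R\alpha},\hat\phi_{\bm R'\beta}^\dagger\}=0\qquad\text{for all }\bm R,\bm R'\in\Lambda,\ \alpha\in\{1,\dots,A_{\bm R}\},\ \beta\in\{1,\dots,B_{\bm R'}\}.$$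
   Context: $\Lambda$ is a finite set of unit cells; each cell $\bm R$ carries finitely many fermionic modes $\hat c_{\bm R\tau}$, $\tau=1,\dots,N_{\bm R}$, acting on the (finite-dimensional) fermionic Fock space and satisfying $\{\hat c_{\bm R\tau},\hat c_{\bm R'\tau'}^\dagger\}=\delta_{\bm R,\bm R'}\delta_{\tau,\tau'}$, $\{\hat c_{\bm R\tau},\hat c_{\bm R'\tau'}\}=0$. $\hat{\bm c}$ is the column vector of all $\hat c_{\bm R\tau}$, and $\hat{\bm c}^\dagger$ the row vector of all $\hat c_{\bm R\tau}^\dagger$. Each $h_{\bm R}$ is a Hermitian matrix on the single-particle space indexed by $(\bm R',\tau)$; it is local, i.e. its matrix elements vanish unless both indices belong to cells within a fixed finite distance $r$ of $\bm R$ (eigenvectors of nonzero eigenvalue are then supported in that region). No translation invariance is assumed. $\{A,B\}=AB+BA$. Frustration-free: writing $E_{\bm R}$ for the smallest eigenvalue of $\hat H_{\bm R}$ on Fock space, $\hat H=\sum_{\bm R}\hat H_{\bm R}$ is frustration-free if there is a nonzero Fock-space vector $|\Phi\rangle$ with $\hat H_{\bm R}|\Phi\rangle=E_{\bm R}|\Phi\rangle$ for all $\bm R\in\Lambda$ simultaneously. *)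

(* Defs.v *)
From HB Require Import structures.
From mathcomp Require Import all_boot all_order all_algebra.
From mathcomp Require Import sesquilinear spectral complex reals.
Set Implicit Arguments.
Unset Strict Implicit.
Unset Printing Implicit Defensive.
Import Order.TTheory GRing.Theory Num.Theory.
Local Open Scope ring_scope.
Local Open Scope sesquilinear_scope.

Section Fock.
Variables (C : numClosedFieldType) (n : nat).

Definition anticomm (d : nat) (A B : 'M[C]_d) : 'M[C]_d := A *m B + B *m A.

(* Occupation-number basis of the Fock space on n modes: one basis vector |S>
   per set S of occupied modes, in the order of occ. *)
Definition fock_dim : nat := #|{set 'I_n}|.

Definition occ (s : 'I_fock_dim) : {set 'I_n} := enum_val s.

Definition jw_sign (k : 'I_n) (T : {set 'I_n}) : C :=
  (-1) ^+ #|[set j in T | (j < k)%N]|.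

(* Jordan-Wigner convention: c_k |S> = (-1)^#{j in S, j < k} |S minus k> if
   k is in S, and 0 otherwise; the column index is the source S. The canonical
   anticommutation relations are anticomm_annih and anticomm_annih_creat below. *)
Definition annih (k : 'I_n) : 'M[C]_fock_dim :=
  \matrix_(s, t)
    if (k \in occ t) && (occ s == occ t :\ k)
    then jw_sign k (occ t) else 0.

Definition creat (k : 'I_n) : 'M[C]_fock_dim := (annih k)^t*.

(* v^dagger c-hat *)
Definition annih_vec (v : 'cV[C]_n) : 'M[C]_fock_dim :=
  \sum_(k < n) (v^t*) 0 k *: annih k.

(* c-hat^dagger h c-hat + a *)
Definition free_term (h : 'M[C]_n) (a : C) : 'M[C]_fock_dim :=
  (\sum_(k < n) \sum_(l < n) h k l *: (creat k *m annih l)) + a%:M.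

(* psi is an orthonormal family of eigenvectors of h for all the eigenvalues
   satisfying P, each repeated according to its multiplicity. The library's
   eigenspace consists of row vectors, hence the transpose. *)
Definition eigenfamily (P : C -> Prop) (h : 'M[C]_n) (A : nat)
    (psi : 'I_A -> 'cV[C]_n) : Prop :=
  (forall a b, (psi a)^t* *m psi b = (a == b)%:R%:M) /\
  exists lam : 'I_A -> C,
    (forall a, P (lam a) /\ h *m psi a = lam a *: psi a) /\
    (forall x, P x -> #|[set a | lam a == x]| = \rank (eigenspace h^T x)).

End Fock.

(* The order on C relates two numbers only if they differ by a real one, so in
   particular all eigenvalues of M are required to be real. The library's
   eigenvalue refers to row eigenvectors, which have the same spectrum. *)
Definition is_smallest_eigenvalue (C : numClosedFieldType) (d : nat)
    (M : 'M[C]_d) (E : C) : Prop :=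
  eigenvalue M E /\ forall x, eigenvalue M x -> E <= x.

(* A property of the decomposition of the sum of the H x into the H x. *)
Definition frustration_free (C : numClosedFieldType) (L : finType) (d : nat)
    (H : L -> 'M[C]_d) : Prop :=
  exists E : L -> C, (forall x, is_smallest_eigenvalue (H x) (E x)) /\
  exists Phi : 'cV[C]_d, Phi != 0 /\ forall x, H x *m Phi = E x *: Phi.

Section Lattice.
Variables (L : finType) (N : L -> nat).

Definition mode : finType := {x : L & 'I_(N x)}.

Definition nmodes : nat := #|mode|.

Definition cell (k : 'I_nmodes) : L := tag (enum_val k).

Definition is_metric (R : realType) (dist : L -> L -> R) : Prop :=
  [/\ forall x y, dist x y = 0 <-> x = y,
      forall x y, dist x y = dist y x &
      forall x y z, dist x z <= dist x y + dist y z].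

Definition local_range (R : realType) (dist : L -> L -> R) (r : R)
    (C : numClosedFieldType) (h : L -> 'M[C]_nmodes) : Prop :=
  forall x k l, h x k l != 0 -> dist (cell k) x <= r /\ dist (cell l) x <= r.

End Lattice.

Section CAR.
Variables (C : numClosedFieldType) (n : nat).
Implicit Types (k l : 'I_n) (S T : {set 'I_n}).
Local Notation jw_sign := (@jw_sign C n).

Lemma sum_occ (F : {set 'I_n} -> C) :
  \sum_(u < fock_dim n) F (occ u) = \sum_S F S.
Proof.
rewrite [RHS](reindex (@occ n)) //.
by exists enum_rank => x _; rewrite /occ ?enum_valK ?enum_rankK.
Qed.

Lemma pick_sum (b : bool) S (x : C) (F : {set 'I_n} -> C) :
  \sum_U (if b && (U == S) then x else 0) * F U = if b then x * F S else 0.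
Proof.
case: b => /=; last by rewrite big1 // => U _; rewrite mul0r.
rewrite (bigD1 S) //= eqxx big1 ?addr0 // => U /negPf->.
by rewrite mul0r.
Qed.

Lemma annihE k (s t : 'I_(fock_dim n)) : annih C k s t =
  if (k \in occ t) && (occ s == occ t :\ k) then jw_sign k (occ t) else 0.
Proof. by rewrite mxE. Qed.

Lemma jw_sign_set1U k l T : l \notin T ->
  jw_sign k (l |: T) = (-1) ^+ (l < k)%N * jw_sign k T.
Proof.
move=> lT; rewrite /jw_sign -exprD; congr (_ ^+ _).
case: ltnP => lk; last first.
  rewrite add0n; apply: eq_card => j; rewrite !inE.
  by case: eqP => // ->; rewrite (negPf lT) ltnNge lk.
rewrite -(_ : #|l |: [set j in T | (j < k)%N]| = 1 + _)%N; last first.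
  by rewrite cardsU1 !inE (negPf lT).
by apply: eq_card => j; rewrite !inE; case: eqP => //= ->.
Qed.

Lemma jw_sign_setD1 k l T : l \in T ->
  jw_sign k (T :\ l) = (-1) ^+ (l < k)%N * jw_sign k T.
Proof.
move=> lT; rewrite -{2}(setD1K lT) jw_sign_set1U ?setD11 //.
by rewrite mulrA -expr2 sqrr_sign mul1r.
Qed.

Lemma jw_sign_sqr k T : jw_sign k T * jw_sign k T = 1.
Proof. by rewrite -expr2 /jw_sign exprAC sqrrN expr1n expr1n. Qed.

Lemma creatE k (s t : 'I_(fock_dim n)) : creat C k s t =
  if (k \notin occ t) && (occ s == k |: occ t) then jw_sign k (occ t) else 0.
Proof.
rewrite !mxE -annihE annihE.
have -> : (k \in occ s) && (occ t == occ s :\ k) =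
          (k \notin occ t) && (occ s == k |: occ t).
  apply/andP/andP => [[ks /eqP->]|[kt /eqP->]].
    by rewrite setD11 setD1K.
  by rewrite setU11 setU1K.
case: ifP => [/andP[kt /eqP->]|_]; last by rewrite conjC0.
by rewrite jw_sign_set1U // ltnn mul1r /jw_sign rmorph_sign.
Qed.

Lemma lt_signs k l : k != l -> (-1) ^+ (l < k)%N + (-1) ^+ (k < l)%N = 0 :> C.
Proof.
by rewrite -val_eqE /=; case: ltngtP => //= _ _;
  rewrite ?expr0 ?expr1 ?subrr ?addNr.
Qed.

Lemma annihM k l (s t : 'I_(fock_dim n)) : (annih C k *m annih C l) s t =
  if [&& l \in occ t, k \in occ t :\ l & occ s == occ t :\ l :\ k]
  then jw_sign l (occ t) * jw_sign k (occ t :\ l) else 0.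
Proof.
rewrite mxE; under eq_bigr do rewrite mulrC !annihE.
pose G (U : {set _}) :=
  if (k \in U) && (occ s == U :\ k) then jw_sign k U else 0.
rewrite (sum_occ (fun U => (if (l \in occ t) && (U == occ t :\ l)
  then jw_sign l (occ t) else 0) * G U)) pick_sum /G.
by do 2 case: ifP => //=; rewrite mulr0.
Qed.

Lemma anticomm_annih k l : anticomm (annih C k) (annih C l) = 0.
Proof.
apply/matrixP => s t; rewrite [LHS]mxE !annihM [RHS]mxE !inE.
have [->|kl] := eqVneq k l; first by rewrite /= !andbF addr0.
rewrite /= setDDl setUC -setDDl.
case: ifP => [/and3P[lt kt ->]|]; last first.
  by rewrite andbCA => ->; rewrite addr0.
rewrite lt kt /= !jw_sign_setD1 // mulrCA [jw_sign k _ * _]mulrCA.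
by rewrite [jw_sign k _ * _]mulrC -mulrDl lt_signs // mul0r.
Qed.

Lemma anticomm_annih_creat k l :
  anticomm (annih C k) (creat C l) = (k == l)%:R%:M.
Proof.
apply/matrixP => s t; rewrite [LHS]mxE [(_ *m _) s t]mxE.
rewrite [(creat C l *m _) s t]mxE.
under eq_bigr do rewrite mulrC creatE annihE.
under [X in _ + X]eq_bigr do rewrite mulrC creatE annihE.
set T := occ t; set S := occ s.
pose G (U : {set _}) := if (k \in U) && (S == U :\ k) then jw_sign k U else 0.
pose G' (U : {set _}) :=
  if (l \notin U) && (S == l |: U) then jw_sign l U else 0.
rewrite (sum_occ (fun U => (if (l \notin T) && (U == l |: T)
  then jw_sign l T else 0) * G U)) pick_sum /G.
rewrite (sum_occ (fun U => (if (k \in T) && (U == T :\ k)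
  then jw_sign k T else 0) * G' U)) pick_sum /G' !mxE.
have eqST : (S == T) = (s == t) by rewrite (inj_eq enum_val_inj).
have [<-|kl] := eqVneq k l.
  rewrite setU11 setD11 /= -eqST; case: (boolP (k \in T)) => kT /=.
    rewrite setD1K // add0r jw_sign_setD1 // ltnn mul1r.
    by case: (S == T); rewrite ?mulr0 ?jw_sign_sqr.
  rewrite setU1K // addr0 jw_sign_set1U // ltnn mul1r.
  by case: (S == T); rewrite ?mulr0 ?jw_sign_sqr.
rewrite mul0rn !inE (negPf kl) [l == k]eq_sym (negPf kl) /=.
case: (boolP (l \in T)) => lT /=; first by rewrite mulr0 if_same addr0.
case: (boolP (k \in T)) => kT /=; last by rewrite mulr0 addr0.
have -> : (l |: T) :\ k = l |: T :\ k.
  apply/setP => j; rewrite !inE; case: (eqVneq j k) => //= ->.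
  by rewrite (negPf kl).
case: (S == _); last by rewrite !mulr0 addr0.
rewrite jw_sign_setD1 // jw_sign_set1U // mulrCA [jw_sign k T * _]mulrCA.
by rewrite [jw_sign k T * _]mulrC -mulrDl lt_signs // mul0r.
Qed.

End CAR.

(* Main.v *)
Require Import Defs.
From mathcomp Require Import all_boot all_order all_algebra.
From mathcomp Require Import sesquilinear spectral complex reals.
Set Implicit Arguments.
Unset Strict Implicit.
Unset Printing Implicit Defensive.
Import Order.TTheory GRing.Theory Num.Theory.
Local Open Scope ring_scope.
Local Open Scope sesquilinear_scope.

(** If h_R = sum_a lam_a psi_a psi_a^+ + sum_b mu_b phi_b phi_b^+ with lam_a > 0
    and mu_b < 0, then the anticommutation relations give
      H_R = sum_a lam_a psi^_a^+ psi^_a + sum_b (- mu_b) phi^_b phi^_b^+ + E_R,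
    a sum of positive terms plus E_R = C_R + sum_b mu_b. Hence <Phi, H_R Phi> =
    E_R <Phi, Phi> forces psi^_a Phi = 0 and phi^_b^+ Phi = 0. Common kernel
    vectors come from anticommutation: if the operators O_i satisfy
    {O_i, O_j} = 0 for all i and j (including i = j) and Phi is killed by
    O_1, ..., O_(m-1), then either Phi or O_m Phi is a nonzero vector killed by
    all of O_1, ..., O_m. Applied to a single cell, this shows that E_R is the
    lowest eigenvalue of H_R; applied to all cells, it gives a frustration-free
    ground state when all psi are orthogonal to all phi. Conversely, a vector
    killed by psi^ and phi^^+ is killed by the scalar {psi^, phi^^+}. *)

(** * Adjoint calculus and the Hermitian inner product of column vectors *)

Section Adjoint.
Variable C : numClosedFieldType.

Lemma adjM m n p (A : 'M[C]_(m, n)) (B : 'M[C]_(n, p)) :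
  (A *m B)^t* = B^t* *m A^t*.
Proof. by rewrite trmx_mul map_mxM. Qed.

Lemma adjZ m n (a : C) (A : 'M[C]_(m, n)) : (a *: A)^t* = a^* *: A^t*.
Proof. by rewrite linearZ /= map_mxZ. Qed.

Lemma adjD m n (A B : 'M[C]_(m, n)) : (A + B)^t* = A^t* + B^t*.
Proof. by rewrite linearD /= map_mxD. Qed.

Lemma adj0 m n : (0 : 'M[C]_(m, n))^t* = 0.
Proof. by rewrite trmx0 map_mx0. Qed.

Lemma adj_sum m n (I : finType) (F : I -> 'M[C]_(m, n)) :
  (\sum_i F i)^t* = \sum_i (F i)^t*.
Proof. exact: (big_morph _ (@adjD m n) (adj0 m n)). Qed.

Definition dotc n (u v : 'cV[C]_n) : C := (u^t* *m v) 0 0.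

Lemma dotcE n (u v : 'cV[C]_n) : dotc u v = \sum_k (u k 0)^* * v k 0.
Proof. by rewrite /dotc mxE; apply: eq_bigr => k _; rewrite !mxE. Qed.

Lemma dotcP n (u v : 'cV[C]_n) : u^t* *m v = (dotc u v)%:M.
Proof. exact: mx11_scalar. Qed.

Lemma dotcDr n (u v w : 'cV[C]_n) : dotc u (v + w) = dotc u v + dotc u w.
Proof. by rewrite /dotc mulmxDr mxE. Qed.

Lemma dotc_sumr n (I : finType) (u : 'cV[C]_n) (F : I -> 'cV[C]_n) :
  dotc u (\sum_i F i) = \sum_i dotc u (F i).
Proof. by rewrite /dotc mulmx_sumr summxE. Qed.

Lemma dotcZr n (a : C) (u v : 'cV[C]_n) : dotc u (a *: v) = a * dotc u v.
Proof. by rewrite /dotc -scalemxAr mxE. Qed.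

Lemma dotcZl n (a : C) (u v : 'cV[C]_n) : dotc (a *: u) v = a^* * dotc u v.
Proof. by rewrite /dotc adjZ -scalemxAl mxE. Qed.

Lemma dotc_adj m n (A : 'M[C]_(m, n)) u v :
  dotc u (A *m v) = dotc (A^t* *m u) v.
Proof. by rewrite /dotc adjM trmxCK mulmxA. Qed.

Lemma dotc_ge0 n (u : 'cV[C]_n) : 0 <= dotc u u.
Proof. by rewrite dotcE sumr_ge0 // => k _; rewrite mulrC mul_conjC_ge0. Qed.

Lemma dotc_eq0 n (u : 'cV[C]_n) : (dotc u u == 0) = (u == 0).
Proof.
apply/eqP/eqP => [u0|->]; last by rewrite /dotc mulmx0 mxE.
move: u0; rewrite dotcE => /psumr_eq0P u0.
apply/colP => k; rewrite mxE; apply/eqP; rewrite -mul_conjC_eq0 mulrC.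
by apply/eqP/u0 => // j _; rewrite mulrC mul_conjC_ge0.
Qed.

Lemma dotc_gt0 n (u : 'cV[C]_n) : (0 < dotc u u) = (u != 0).
Proof. by rewrite lt0r dotc_eq0 dotc_ge0 andbT. Qed.

End Adjoint.

(** * Ground states of a positive sum plus a constant *)

Section PositiveSum.
Variables (C : numClosedFieldType) (d : nat) (I : finType).
Variables (w : I -> C) (O : I -> 'M[C]_d) (E : C).
Hypothesis w_gt0 : forall i, 0 < w i.

Local Notation M := (\sum_i w i *: ((O i)^t* *m O i) + E%:M).

Lemma positive_sum_form (u : 'cV[C]_d) :
  dotc u (M *m u) = \sum_i w i * dotc (O i *m u) (O i *m u) + E * dotc u u.
Proof.
rewrite mulmxDl mul_scalar_mx dotcDr dotcZr mulmx_suml dotc_sumr.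
congr (_ + _); apply: eq_bigr => i _.
by rewrite -scalemxAl dotcZr -mulmxA dotc_adj trmxCK.
Qed.

Lemma positive_sum_ground (Phi : 'cV[C]_d) :
  M *m Phi = E *: Phi -> forall i, O i *m Phi = 0.
Proof.
move=> eMPhi i; have := positive_sum_form Phi.
(* The contribution [E * dotc Phi Phi] cancels on both sides and leaves a vanishing sum of
   nonnegative terms. *)
rewrite eMPhi dotcZr -[LHS]add0r => /addIr/esym/psumr_eq0P H.
apply/eqP; rewrite -dotc_eq0 -(mulrI_eq0 _ (lregP (lt0r_neq0 (w_gt0 i)))).
by apply/eqP/H => // j _; rewrite mulr_ge0 ?dotc_ge0 // ltW.
Qed.

Lemma kernel_positive_sum (Phi : 'cV[C]_d) :
  (forall i, O i *m Phi = 0) -> M *m Phi = E *: Phi.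
Proof.
move=> OPhi; rewrite mulmxDl mul_scalar_mx mulmx_suml big1 ?add0r // => i _.
by rewrite -scalemxAl -mulmxA OPhi mulmx0 scaler0.
Qed.

Lemma kernel_smallest_eigenvalue (Phi : 'cV[C]_d) :
  Phi != 0 -> (forall i, O i *m Phi = 0) -> is_smallest_eigenvalue M E.
Proof.
move=> Phi0 OPhi; split.
  (* [eigenvalue] asks for a row eigenvector. The adjoint of [Phi] is one, since on the left it
     meets the adjoint of [O i] first, and that product is the adjoint of [O i *m Phi]. *)
  apply/eigenvalueP; exists (Phi^t*).
    rewrite mulmxDr mul_mx_scalar mulmx_sumr big1 ?add0r // => i _.
    by rewrite -scalemxAr mulmxA -adjM OPhi adj0 mul0mx scaler0.
  by apply: contra_neq Phi0 => /(congr1 (fun X => X^t*)); rewrite trmxCK adj0.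
move=> x /eigenvalueP[v]; rewrite -[v]trmxCK; set u := v^t* => uM u_neq0.
have u0 : u != 0 by apply: contra_neq u_neq0 => ->; rewrite adj0.
(* The quadratic form at [u] equals [x * dotc u u] and also exceeds [E * dotc u u] by a nonnegative
   sum; dividing by [dotc u u] gives the bound. *)
have := positive_sum_form u; rewrite {1}/dotc mulmxA uM -scalemxAl mxE => eq1.
rewrite -(ler_pM2r (x := dotc u u)) ?dotc_gt0 // [leRHS]eq1 lerDr.
by apply: sumr_ge0 => i _; rewrite mulr_ge0 ?dotc_ge0 // ltW.
Qed.

End PositiveSum.

(** * Common kernel vectors of anticommuting operators *)

Section CommonKernel.
Variables (C : numClosedFieldType) (d : nat).

Lemma anticomm_kernel (T : eqType) (O : T -> 'M[C]_d) (s : seq T)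
    (Phi0 : 'cV[C]_d) :
  Phi0 != 0 -> (forall i j, anticomm (O i) (O j) = 0) ->
  exists2 Phi : 'cV[C]_d, Phi != 0 & forall i, i \in s -> O i *m Phi = 0.
Proof.
move=> Phi0_neq0 O_anti; elim: s => [|i s [Phi Phi_neq0 OPhi]].
  by exists Phi0.
have [OiPhi|OiPhi] := eqVneq (O i *m Phi) 0.
  by exists Phi => // j; rewrite inE => /predU1P[->|/OPhi].
exists (O i *m Phi) => // j; rewrite inE mulmxA => /predU1P[->|/OPhi OjPhi].
  (* The case i = j says that twice the square of [O i] vanishes, so the square does. *)
  have /eqP := O_anti i i; rewrite /anticomm -mulr2n -scaler_nat scaler_eq0.
  by rewrite pnatr_eq0 /= => /eqP->; rewrite mul0mx.
have /eqP := O_anti j i; rewrite /anticomm addr_eq0 => /eqP->.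
by rewrite mulNmx -mulmxA OjPhi mulmx0 oppr0.
Qed.

End CommonKernel.

(** * Anticommutation relations and quadratic terms for arbitrary one-particle vectors *)

Section VectorCAR.
Variables (C : numClosedFieldType) (n : nat).
Implicit Types v w : 'cV[C]_n.

Lemma annih_vecE v : annih_vec v = \sum_k (v k 0)^* *: annih C k.
Proof. by apply: eq_bigr => k _; rewrite !mxE. Qed.

Lemma creat_vecE v : (annih_vec v)^t* = \sum_k v k 0 *: creat C k.
Proof.
by rewrite annih_vecE adj_sum; apply: eq_bigr => k _; rewrite adjZ conjCK.
Qed.

Lemma anticomm_sum d (I J : finType) (a : I -> C) (b : J -> C)
    (X : I -> 'M[C]_d) (Y : J -> 'M[C]_d) :
  anticomm (\sum_i a i *: X i) (\sum_j b j *: Y j) =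
  \sum_i \sum_j (a i * b j) *: anticomm (X i) (Y j).
Proof.
rewrite /anticomm mulmx_suml mulmx_sumr -big_split; apply: eq_bigr => i _ /=.
rewrite mulmx_suml mulmx_sumr -big_split; apply: eq_bigr => j _ /=.
by rewrite -!scalemxAl -!scalemxAr !scalerA scalerDr [b j * a i]mulrC.
Qed.

Lemma anticomm_annih_vec v w : anticomm (annih_vec v) (annih_vec w) = 0.
Proof.
rewrite !annih_vecE anticomm_sum big1 // => k _; rewrite big1 // => l _.
by rewrite anticomm_annih scaler0.
Qed.

Lemma anticomm_creat_vec v w :
  anticomm ((annih_vec v)^t*) ((annih_vec w)^t*) = 0.
Proof.
by rewrite /anticomm -!adjM -adjD -/(anticomm _ _) anticomm_annih_vec adj0.
Qed.

Lemma anticomm_annih_creat_vec v w :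
  anticomm (annih_vec v) ((annih_vec w)^t*) = (dotc v w)%:M.
Proof.
rewrite annih_vecE creat_vecE anticomm_sum dotcE rmorph_sum /=.
apply: eq_bigr => k _; rewrite (bigD1 k) //= big1 => [|l lk].
  by rewrite anticomm_annih_creat eqxx addr0 scale_scalar_mx mulr1.
by rewrite anticomm_annih_creat eq_sym (negPf lk) scale_scalar_mx mulr0 raddf0.
Qed.

Lemma anticommC d (X Y : 'M[C]_d) : anticomm X Y = anticomm Y X.
Proof. by rewrite /anticomm addrC. Qed.

(** The empty set always indexes a basis vector, so Fock space is nonzero even without modes. This
    provides the starting vector for [anticomm_kernel]. *)
Lemma fock_neq0 : exists Phi : 'cV[C]_(fock_dim n), Phi != 0.
Proof.
exists (const_mx 1); apply/eqP => /colP/(_ (enum_rank set0))/eqP.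
by rewrite !mxE oner_eq0.
Qed.

Lemma free_termD (g h : 'M[C]_n) a b :
  free_term (g + h) (a + b) = free_term g a + free_term h b.
Proof.
rewrite /free_term raddfD /= addrACA; congr (_ + _).
rewrite -big_split; apply: eq_bigr => k _ /=.
by rewrite -big_split; apply: eq_bigr => l _ /=; rewrite mxE scalerDl.
Qed.

Lemma free_term_scalar a : free_term 0 a = a%:M :> 'M[C]_(fock_dim n).
Proof.
rewrite /free_term big1 ?add0r // => k _; rewrite big1 // => l _.
by rewrite mxE scale0r.
Qed.

Lemma free_term_rank1 (a : C) v :
  free_term (a *: (v *m v^t*)) 0 = a *: ((annih_vec v)^t* *m annih_vec v).
Proof.
rewrite /free_term raddf0 addr0 creat_vecE annih_vecE mulmx_suml scaler_sumr.
apply: eq_bigr => k _; rewrite mulmx_sumr scaler_sumr; apply: eq_bigr => l _.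
by rewrite !mxE big_ord1 !mxE -scalemxAl -scalemxAr !scalerA mulrA.
Qed.

Lemma free_term_sum (I : finType) (a : I -> C) (v : I -> 'cV[C]_n) :
  free_term (\sum_i a i *: (v i *m (v i)^t*)) 0 =
  \sum_i a i *: ((annih_vec (v i))^t* *m annih_vec (v i)).
Proof.
have F0 : free_term 0 0 = 0 :> 'M[C]_(fock_dim n).
  by rewrite free_term_scalar raddf0.
have FD g h : @free_term C n (g + h) 0 = free_term g 0 + free_term h 0.
  by rewrite -free_termD addr0.
rewrite (big_morph (fun g => @free_term C n g 0) FD F0).
by apply: eq_bigr => i _; rewrite free_term_rank1.
Qed.

End VectorCAR.

(** * Spectral decomposition of a Hermitian matrix along its signed eigenfamilies *)

Section Spectral.
Variables (C : numClosedFieldType) (n : nat) (h : 'M[C]_n).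
Hypothesis h_herm : h \is hermsymmx.

Lemma herm_adj : h^t* = h.
Proof. by have /is_hermitianmxP := h_herm; rewrite expr0 scale1r => {2}->. Qed.

Lemma herm_eigen_orth (x y : C) (u v : 'cV[C]_n) : x \is Num.real ->
  h *m u = x *: u -> h *m v = y *: v -> x != y -> dotc u v = 0.
Proof.
move=> x_real hu hv xy; have : dotc u (h *m v) = dotc (h *m u) v.
  by rewrite dotc_adj herm_adj.
rewrite hu hv dotcZr dotcZl (CrealP x_real) => /eqP.
by rewrite -subr_eq0 -mulrBl mulf_eq0 subr_eq0 eq_sym (negPf xy) => /eqP.
Qed.

(** By the spectral theorem the columns of [invmx P] form a basis of eigenvectors with real
    eigenvalues, so matrix identities can be tested on such vectors alone. *)
Lemma herm_eigenvectors_eq0 (D : 'M[C]_n) :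
  (forall (x : C) (u : 'cV[C]_n),
     x \is Num.real -> h *m u = x *: u -> D *m u = 0) ->
  D = 0.
Proof.
move=> D0; set P := spectralmx h; have P_unit : P \in unitmx := spectral_unit h.
have hP : h *m invmx P = invmx P *m diag_mx (spectral_diag h).
  have /orthomx_spectralP {1}-> := hermitian_normalmx h_herm.
  by rewrite -/P -!mulmxA mulmxV // mulmx1.
suff DP : D *m invmx P = 0 by rewrite -(mulmxKV P_unit D) DP mul0mx.
apply/matrixP => i k.
have hPk : h *m (invmx P *m delta_mx k (0 : 'I_1)) =
    spectral_diag h 0 k *: (invmx P *m delta_mx k (0 : 'I_1)).
  rewrite mulmxA hP -mulmxA scalemxAr; congr (_ *m _).
  apply/matrixP => j l; rewrite mul_diag_mx !mxE.
  by case: eqP => [->|]; rewrite ?mulr0.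
have := D0 _ _ (mxOverP (hermitian_spectral_diag_real h_herm) 0 k) hPk.
by rewrite mulmxA -colE => /colP/(_ i); rewrite !mxE.
Qed.

(** A dimension count: the vectors indexed by [s] are independent, lie in the eigenspace, and are as
    many as its dimension. They become the rows of [W] to match the row convention of
    [eigenspace]. *)
Lemma orthonormal_span (A : nat) (psi : 'I_A -> 'cV[C]_n) (s : {set 'I_A})
    (x : C) (u : 'cV[C]_n) :
  (forall a b, (psi a)^t* *m psi b = (a == b)%:R%:M) ->
  (forall a, a \in s -> h *m psi a = x *: psi a) ->
  #|s| = \rank (eigenspace h^T x) -> h *m u = x *: u ->
  exists c : 'I_A -> C, u = \sum_a c a *: psi a.
Proof.
move=> psi_on psi_x s_rank hu.
pose W := \matrix_(i < #|s|) (psi (enum_val i))^T.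
have W_on : map_mx Num.conj W *m W^T = 1%:M.
  apply/matrixP => i j; rewrite !mxE -(inj_eq enum_val_inj).
  have /matrixP/(_ 0 0) := psi_on (enum_val i) (enum_val j).
  rewrite dotcP !mxE !mulr1n dotcE => <-.
  by apply: eq_bigr => k _; rewrite !mxE.
have W_free : \rank W = #|s|.
  apply/eqP; rewrite -/(row_free W); apply/row_freeP.
  exists (map_mx Num.conj W)^T.
  by apply: trmx_inj; rewrite trmx_mul trmxK W_on trmx1.
have W_eig : (W <= eigenspace h^T x)%MS.
  apply/row_subP => i; apply/eigenspaceP.
  by rewrite rowK -trmx_mul psi_x ?enum_valP // linearZ.
have eig_W : (eigenspace h^T x <= W)%MS.
  by rewrite -(mxrank_leqif_sup W_eig) W_free -s_rank.
have /submxP[c uE] : (u^T <= W)%MS.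
  apply: submx_trans eig_W; apply/eigenspaceP.
  by rewrite -trmx_mul hu linearZ.
have {uE} -> : u = \sum_(i < #|s|) c 0 i *: psi (enum_val i).
  apply: trmx_inj; rewrite uE mulmx_sum_row raddf_sum /=.
  by apply: eq_bigr => i _; rewrite rowK linearZ.
(* Each fibre of [enum_val] has at most one element, and is empty for [a] outside [s], where the
   coefficient is therefore 0. *)
exists (fun a => \sum_(i < #|s| | enum_val i == a) c 0 i).
rewrite (partition_big (@enum_val _ _) predT) //=; apply: eq_bigr => a _.
by rewrite scaler_suml; apply: eq_bigr => i /eqP->.
Qed.

(** The sum is [h] cut down to the eigenspaces selected by [P]. On an eigenvector [u], orthogonality
    removes every term with [lam a] different from [x]; the rest is the expansion of [u] in an
    orthonormal basis of its eigenspace. *)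
Lemma eigenfamily_apply (P : C -> Prop) (A : nat) (psi : 'I_A -> 'cV[C]_n)
    (lam : 'I_A -> C) (x : C) (u : 'cV[C]_n) (b : bool) :
  (forall a b, (psi a)^t* *m psi b = (a == b)%:R%:M) ->
  (forall a, P (lam a) /\ h *m psi a = lam a *: psi a) ->
  (forall x, P x -> #|[set a | lam a == x]| = \rank (eigenspace h^T x)) ->
  (forall x, P x -> x \is Num.real) ->
  reflect (P x) b -> h *m u = x *: u ->
  (\sum_a lam a *: (psi a *m (psi a)^t*)) *m u = if b then x *: u else 0.
Proof.
move=> psi_on psi_lam psi_rank P_real bP hu.
(* Replacing [lam a] by [x] is harmless: where they differ, the inner product with [u] vanishes. *)
rewrite mulmx_suml (eq_bigr (fun a => x *: (psi a *m ((psi a)^t* *m u)))).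
  case: bP => [Px|nPx]; last first.
    rewrite big1 // => a _; have [Pa psia] := psi_lam a.
    rewrite dotcP (herm_eigen_orth (P_real _ Pa) psia hu).
      by rewrite raddf0 mulmx0 scaler0.
    by apply: contra_not_neq nPx => <-.
  have [|c ->] := orthonormal_span psi_on _ (psi_rank x Px) hu.
    by move=> a; rewrite inE => /eqP<-; have [] := psi_lam a.
  rewrite -scaler_sumr; congr (_ *: _); apply: eq_bigr => a _.
  rewrite mulmx_sumr (bigD1 a) //= big1 => [|j ja].
    by rewrite addr0 -!scalemxAr psi_on eqxx mulmx1.
  by rewrite -scalemxAr psi_on eq_sym (negPf ja) raddf0 scaler0.
move=> a _; have [Pa psia] := psi_lam a; rewrite -scalemxAl -mulmxA.
have [->//|lamx] := eqVneq (lam a) x.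
rewrite dotcP (herm_eigen_orth (P_real _ Pa) psia hu lamx).
by rewrite raddf0 mulmx0 !scaler0.
Qed.

Lemma herm_decomposition (A B : nat)
    (psi : 'I_A -> 'cV[C]_n) (phi : 'I_B -> 'cV[C]_n) :
  eigenfamily (fun e => 0 < e) h psi -> eigenfamily (fun e => e < 0) h phi ->
  exists2 lam : 'I_A -> C, (forall a, 0 < lam a) &
  exists2 mu : 'I_B -> C, (forall b, mu b < 0) &
  h = \sum_a lam a *: (psi a *m (psi a)^t*) +
      \sum_b mu b *: (phi b *m (phi b)^t*).
Proof.
move=> [psi_on [lam [psi_lam psi_rank]]] [phi_on [mu [phi_mu phi_rank]]].
exists lam; first by move=> a; have [] := psi_lam a.
exists mu; first by move=> b; have [] := phi_mu b.
apply/eqP; rewrite -subr_eq0; apply/eqP/herm_eigenvectors_eq0 => x u x_real hu.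
rewrite mulmxBl mulmxDl hu.
rewrite (eigenfamily_apply (x := x) psi_on psi_lam psi_rank _ idP hu);
  last exact: gtr0_real.
rewrite (eigenfamily_apply (x := x) phi_on phi_mu phi_rank _ idP hu);
  last exact: ltr0_real.
(* Exactly one of the two sums reproduces [h] when [x] is nonzero; for [x] = 0 both vanish, as does
   [h *m u]. *)
have [x_gt0|x_lt0|->] := real_ltgt0P x_real.
- by rewrite addr0 subrr.
- by rewrite add0r subrr.
- by rewrite scale0r addr0 subrr.
Qed.

End Spectral.

(** * The Hamiltonian of a single cell and its ground states *)

Section CellTerm.
Variables (C : numClosedFieldType) (n : nat).

(** These operators kill precisely the states in which the positive modes are empty and the negative
    modes are filled, hence the creation operators for [phi]. *)
Definition cell_op (A B : nat) (psi : 'I_A -> 'cV[C]_n) (phi : 'I_B -> 'cV[C]_n)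
    (i : 'I_A + 'I_B) : 'M[C]_(fock_dim n) :=
  match i with
  | inl a => annih_vec (psi a)
  | inr b => (annih_vec (phi b))^t*
  end.

Lemma anticomm_cell_op (A B A' B' : nat)
    (psi : 'I_A -> 'cV[C]_n) (phi : 'I_B -> 'cV[C]_n)
    (psi' : 'I_A' -> 'cV[C]_n) (phi' : 'I_B' -> 'cV[C]_n) i j :
  (forall a b, anticomm (annih_vec (psi a)) ((annih_vec (phi' b))^t*) = 0) ->
  (forall a b, anticomm (annih_vec (psi' a)) ((annih_vec (phi b))^t*) = 0) ->
  anticomm (cell_op psi phi i) (cell_op psi' phi' j) = 0.
Proof.
move=> H H'; case: i j => [a|b] [a'|b'] /=; rewrite ?H //.
- exact: anticomm_annih_vec.
- by rewrite anticommC H'.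
- exact: anticomm_creat_vec.
Qed.

Variables (h : 'M[C]_n) (A B : nat).
Variables (psi : 'I_A -> 'cV[C]_n) (phi : 'I_B -> 'cV[C]_n).
Hypothesis h_herm : h \is hermsymmx.
Hypothesis psi_pos : eigenfamily (fun e => 0 < e) h psi.
Hypothesis phi_neg : eigenfamily (fun e => e < 0) h phi.

Lemma free_term_positive_sum (c : C) :
  exists E : C, exists2 w : 'I_A + 'I_B -> C, forall i, 0 < w i &
  free_term h c =
  \sum_i w i *: ((cell_op psi phi i)^t* *m cell_op psi phi i) + E%:M.
Proof.
have [lam lam_gt0 [mu mu_lt0 hE]] := herm_decomposition h_herm psi_pos phi_neg.
exists (\sum_b mu b + c).
exists (fun i => match i with inl a => lam a | inr b => - mu b end).
  by case=> [a|b]; rewrite ?oppr_gt0.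
have -> : free_term h c = free_term h 0 + c%:M.
  by rewrite -free_term_scalar -free_termD addr0 add0r.
have -> : free_term h 0 =
    free_term (\sum_a lam a *: (psi a *m (psi a)^t*)) 0 +
    free_term (\sum_b mu b *: (phi b *m (phi b)^t*)) 0.
  by rewrite -free_termD addr0 -hE.
rewrite !free_term_sum big_sumType /= -!addrA.
congr (_ + _); rewrite raddfD addrA; congr (_ + _).
rewrite raddf_sum -big_split; apply: eq_bigr => b _ /=.
have phib : dotc (phi b) (phi b) = 1.
  by have [phi_on _] := phi_neg; rewrite /dotc phi_on eqxx mxE.
have := anticomm_annih_creat_vec (phi b) (phi b); rewrite phib.
(* Since [phi b] is a unit vector, swapping the two factors flips the sign of the weight [mu b] and
   releases the constant [mu b]. *)
move=> /(canRL (addKr _)) ->; rewrite trmxCK.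
by rewrite scalerDr scale_scalar_mx mulr1 scalerN scaleNr.
Qed.

(** Within one cell, [psi] and [phi] belong to eigenvalues of opposite sign, so they are orthogonal
    and all operators of the cell anticommute. *)
Lemma cell_kernel : exists2 Phi : 'cV[C]_(fock_dim n),
  Phi != 0 & forall i, cell_op psi phi i *m Phi = 0.
Proof.
have orth a b : anticomm (annih_vec (psi a)) ((annih_vec (phi b))^t*) = 0.
  have [_ [lam [/(_ a)[lam_gt0 psia] _]]] := psi_pos.
  have [_ [mu [/(_ b)[mu_lt0 phib] _]]] := phi_neg.
  rewrite anticomm_annih_creat_vec.
  rewrite (herm_eigen_orth h_herm (gtr0_real lam_gt0) psia phib) ?raddf0 //.
  by rewrite gt_eqF // (lt_trans mu_lt0).
have [Phi0 Phi0_neq0] := fock_neq0 C n.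
have [|Phi Phi_neq0 OPhi] :=
  anticomm_kernel (O := cell_op psi phi) (enum {: 'I_A + 'I_B}) Phi0_neq0.
  by move=> i j; apply: anticomm_cell_op.
by exists Phi => // i; rewrite OPhi ?mem_enum.
Qed.

End CellTerm.

(** * Frustration-freeness as orthogonality of positive and negative modes across cells *)

Lemma smallest_eigenvalue_inj (C : numClosedFieldType) d (M : 'M[C]_d) E E' :
  is_smallest_eigenvalue M E -> is_smallest_eigenvalue M E' -> E = E'.
Proof.
by move=> [ME minE] [ME' minE']; apply/le_anti; rewrite minE // minE'.
Qed.

Local Open Scope complex_scope.

Theorem mainTheorem1 (R : realType) (L : finType) (N : L -> nat)
  (dist : L -> L -> R) (r : R)
  (h : L -> 'M[R[i]]_(nmodes N)) (c0 : L -> R)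
  (A B : L -> nat)
  (psi : forall x, 'I_(A x) -> 'cV[R[i]]_(nmodes N))
  (phi : forall x, 'I_(B x) -> 'cV[R[i]]_(nmodes N))
  (dist_metric : is_metric dist)
  (h_herm : forall x, h x \is hermsymmx)
  (h_local : local_range dist r h)
  (psi_pos : forall x, eigenfamily (fun e => 0 < e) (h x) (psi x))
  (phi_neg : forall x, eigenfamily (fun e => e < 0) (h x) (phi x)) :
  frustration_free (fun x => free_term (h x) (c0 x)%:C) <->
  (forall (x y : L) (a : 'I_(A x)) (b : 'I_(B y)),
     anticomm (annih_vec (psi x a)) ((annih_vec (phi y b))^t*) = 0).
Proof.
pose O x := cell_op (psi x) (phi x).
have [E EP] := fin_all_exists (fun x =>
  free_term_positive_sum (h_herm x) (psi_pos x) (phi_neg x) (c0 x)%:C).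
have E_min x : is_smallest_eigenvalue (free_term (h x) (c0 x)%:C) (E x).
  have [w w_gt0 ->] := EP x.
  have [Phi] := cell_kernel (h_herm x) (psi_pos x) (phi_neg x).
  exact: kernel_smallest_eigenvalue.
split=> [[E' [E'_min [Phi [Phi_neq0 HPhi]]]] x y a b|orth].
  have OPhi z i : O z i *m Phi = 0.
    have := HPhi z; rewrite -(smallest_eigenvalue_inj (E_min z) (E'_min z)).
    have [w w_gt0 ->] := EP z => /(positive_sum_ground w_gt0).
    exact.
  rewrite anticomm_annih_creat_vec.
  have [->|d_neq0] := eqVneq (dotc (psi x a) (phi y b)) 0.
    by rewrite raddf0.
  (* Both products in the anticommutator kill [Phi], so a nonzero scalar times the nonzero vector
     [Phi] would be 0. *)
  have := congr1 (mulmx^~ Phi) (anticomm_annih_creat_vec (psi x a) (phi y b)).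
  rewrite /anticomm mulmxDl -!mulmxA (OPhi x (inl a)) (OPhi y (inr b)).
  rewrite !mulmx0 addr0 mul_scalar_mx => /esym/eqP.
  by rewrite scaler_eq0 (negPf d_neq0) (negPf Phi_neq0).
have [Phi0 Phi0_neq0] := fock_neq0 R[i] (nmodes N).
(* The operators of all cells are gathered into one family over a dependent sum, because the numbers
   of modes vary with the cell. *)
have [|Phi Phi_neq0 OPhi] := anticomm_kernel
  (O := fun t : {x : L & ('I_(A x) + 'I_(B x))%type} => O (tag t) (tagged t))
  (enum {: {x : L & ('I_(A x) + 'I_(B x))%type}}) Phi0_neq0.
  by move=> s t; apply: anticomm_cell_op => a b; apply: orth.
exists E; split=> //; exists Phi; split=> // x; have [w w_gt0 ->] := EP x.
apply: kernel_positive_sum => i.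
by rewrite (OPhi (Tagged (fun x => ('I_(A x) + 'I_(B x))%type) i)) ?mem_enum.
Qed.
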